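(* Suppose that for every prime $p$, Terao's conjecture holds over $\mathbb{F}_p$, i.e. for every $l\ge1$ and any two central arrangements $\mathcal{A}^{(1)},\mathcal{A}^{(2)}$ in $\mathbb{F}_p^l$ that are combinatorially equivalent (equivalently, have isomorphic intersection lattices), $\mathcal{A}^{(1)}$ is free if and only if $\mathcal{A}^{(2)}$ is free. Then Terao's conjecture holds over $\mathbb{Q}$: for every $l\ge1$ and any two combinatorially equivalent central arrangements $\mathcal{A}^{(1)},\mathcal{A}^{(2)}$ in $\mathbb{Q}^l$, $\mathcal{A}^{(1)}$ is free if and only if $\mathcal{A}^{(2)}$ is free.
   Context: A central arrangement $\mathcal{A}=\{H_1,\dots,H_n\}$ in $K^l$ consists of distinct linear hyperplanes $H_i=\{\alpha_i=0\}$, $\alpha_i$ linear forms in $S=K[x_1,\dots,x_l]$, $Q(\mathcal{A})=\prod\alpha_i$. Its module of logarithmic vector fields is $D(\mathcal{A})=\{\delta=\sum_i f_i\partial_{x_i}: f_i\in S,\ \delta(\alpha_i)\in\alpha_iS\ \forall i\}$; $\mathcal{A}$ is free if $D(\mathcal{A})$ is a free $S$-module (then it has a homogeneous basis, whose polynomial degrees are the exponents). Two arrangements of $n$ indexed hyperplanes $\{H^{(1)}_i\}$ in $K_1^l$ and $\{H^{(2)}_i\}$ in $K_2^l$ are combinatorially equivalent if $\dim(H^{(1)}_{i_1}\cap\dots\cap H^{(1)}_{i_k})=\dim(H^{(2)}_{i_1}\cap\dots\cap H^{(2)}_{i_k})$ for all $1\le i_1<\dots<i_k\le n$. *)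

(* Defs.v *)
From mathcomp Require Import all_boot all_algebra.
From mathcomp Require Import mpoly.

Set Implicit Arguments.
Unset Strict Implicit.
Unset Printing Implicit Defensive.

Import GRing.Theory.
Local Open Scope ring_scope.

(* A central arrangement of n hyperplanes in K^l is encoded by a matrix
   A : 'M[K]_(n, l) whose i-th row is the coefficient vector of the linear
   form alpha_i = \sum_j A i j * x_j ; H_i = {x | alpha_i(x) = 0}. *)

Section Arrangements.
Variables (K : fieldType) (n l : nat).
Implicit Types (A : 'M[K]_(n, l)).

Definition hyp_space A (i : 'I_n) : 'M[K]_l := kermx (row i A)^T.

Definition inter_space A (I : {set 'I_n}) : 'M[K]_l :=
  (\bigcap_(i in I) hyp_space A i)%MS.

Definition is_arrangement A : Prop :=
  (forall i, row i A != 0) /\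
  (forall i j, i != j -> ~~ (hyp_space A i == hyp_space A j)%MS).

Definition lform A (i : 'I_n) : {mpoly K[l]} := \sum_(j < l) A i j *: 'X_j.

(* A vector field delta = \sum_j f_j d/dx_j is given by f : 'I_l -> S. *)
Definition der_app (f : 'I_l -> {mpoly K[l]}) (p : {mpoly K[l]}) : {mpoly K[l]} :=
  \sum_(j < l) f j * mderiv j p.

Definition in_logder A (f : 'I_l -> {mpoly K[l]}) : Prop :=
  forall i, exists q : {mpoly K[l]}, der_app f (lform A i) = lform A i * q.

Definition free_arr A : Prop :=
  exists (m : nat) (b : 'I_m -> 'I_l -> {mpoly K[l]}),
    [/\ forall k, in_logder A (b k),
        forall f, in_logder A f ->
          exists c : 'I_m -> {mpoly K[l]}, forall j, f j = \sum_(k < m) c k * b k j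
      & forall c : 'I_m -> {mpoly K[l]},
          (forall j, \sum_(k < m) c k * b k j = 0) -> forall k, c k = 0].

End Arrangements.

Definition comb_equiv (K1 K2 : fieldType) (n l : nat)
  (A1 : 'M[K1]_(n, l)) (A2 : 'M[K2]_(n, l)) : Prop :=
  forall I : {set 'I_n}, \rank (inter_space A1 I) = \rank (inter_space A2 I).

Definition terao_conj (K : fieldType) : Prop :=
  forall (l : nat), (1 <= l)%N -> forall (n : nat) (A1 A2 : 'M[K]_(n, l)),
    is_arrangement A1 -> is_arrangement A2 -> comb_equiv A1 A2 ->
    (free_arr A1 <-> free_arr A2).

(* Main.v *)
(** By Saito's criterion, an arrangement of [n] hyperplanes over a field is free
    if and only if there are [l] logarithmic fields of degrees [d_k] with
    [\sum d_k <= n] and nonzero determinant ([saito] below).  Such a family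
    exists over [rat] iff it exists over ['F_p], for almost all primes [p]: from
    [rat] to ['F_p] one clears denominators and reduces; conversely, logarithmic
    fields of degree at most [n] are the solutions of a fixed finite integer
    linear system, and by the Smith normal form every solution modulo a large
    prime lifts to an integer solution.  Since the ranks of the intersections
    are also preserved modulo large primes, the two rational arrangements may be
    compared after reduction modulo a single large prime. *)

Require Import Defs.
From mathcomp Require Import all_boot all_algebra.
From mathcomp Require Import perm fraction.
From mathcomp Require Import mpoly.

Set Implicit Arguments.
Unset Strict Implicit.
Unset Printing Implicit Defensive.

Import GRing.Theory.
Local Open Scope ring_scope.

(** * Linear forms *)

Definition linform (R : comNzRingType) l (a : 'I_l -> R) : {mpoly R[l]} :=
  \sum_(j < l) a j *: 'X_j.

Lemma linform_coef (R : comNzRingType) l (a : 'I_l -> R) j :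
  (linform a)@_U_(j) = a j.
Proof.
rewrite raddf_sum (bigD1 j) //= mcoeffZ mcoeffXU eqxx mulr1 big1 ?addr0 //.
by move=> k ne_kj; rewrite mcoeffZ mcoeffXU (negPf ne_kj) mulr0.
Qed.

Lemma linform_eq0 (R : comNzRingType) l (a : 'I_l -> R) :
  linform a = 0 -> forall j, a j = 0.
Proof. by move=> a0 j; rewrite -linform_coef a0 mcoeff0. Qed.

Lemma linform_homog (R : comNzRingType) l (a : 'I_l -> R) :
  linform a \is 1.-homog.
Proof.
by apply: rpred_sum => j _; apply: rpredZ; rewrite dhomogX /= mdeg1.
Qed.

Lemma der_app_lform (K : fieldType) n l (A : 'M[K]_(n, l)) f i :
  der_app f (lform A i) = \sum_(j < l) A i j *: f j.
Proof.
rewrite /der_app /lform; apply: eq_bigr => j _.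
rewrite raddf_sum (bigD1 j) //= mderivZ mderivX mnm1E eqxx scale1r big1.
  have ->: (U_(j) - U_(j) = 0)%MM by apply/mnmP=> k; rewrite mnmBE subnn mnm0E.
  by rewrite mpolyX0 addr0 -scalerAr mulr1.
by move=> k ne_kj; rewrite mderivZ mderivX mnm1E (negPf ne_kj) scale0r scaler0.
Qed.

(** * Eliminating a variable along a linear form *)

Section Elimination.
Variables (K : fieldType) (l : nat) (a : 'I_l -> K) (j0 : 'I_l).
Hypothesis a0 : a j0 != 0.

(* The substitution solving [linform a = 0] for the variable [j0]: its kernel is
   the ideal of [linform a], which is therefore prime. *)
Definition elim_tuple : l.-tuple {mpoly K[l]} :=
  [tuple 'X_j - ((j == j0)%:R / a j0) *: linform a | j < l].

(** Each variable is congruent to its image modulo [linform a], and such congruences pass to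
    products and linear combinations. *)
Lemma elim_sub p : exists q, p = p \mPo elim_tuple + linform a * q.
Proof.
have mulP x y : (exists q, x = x \mPo elim_tuple + linform a * q) ->
    (exists q, y = y \mPo elim_tuple + linform a * q) ->
    exists q, x * y = (x * y) \mPo elim_tuple + linform a * q.
  move=> [q1 e1] [q2 e2].
  exists (x * q2 + q1 * (y \mPo elim_tuple)).
  rewrite rmorphM /= mulrDr mulrA addrCA mulrA -mulrDl -e1 {1}e2 mulrDr addrC.
  by rewrite mulrCA mulrA.
elim/mpolyind: p => [|c m p _ _ [q e]].
  by exists 0; rewrite comp_mpoly0 mulr0 addr0.
have [r er] : exists q, 'X_[m] = 'X_[m] \mPo elim_tuple + linform a * q.
  rewrite mpolyXE_id.
  apply: (big_ind (fun x => exists q,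
    x = x \mPo elim_tuple + linform a * q)) => //.
    by exists 0; rewrite comp_mpoly1 mulr0 addr0.
  move=> j _; elim: (m j) => [|k IHk].
    by exists 0; rewrite expr0 comp_mpoly1 mulr0 addr0.
  rewrite exprS; apply: mulP => //.
  exists ((j == j0)%:R / a j0)%:MP.
  rewrite comp_mpolyXU -tnth_nth tnth_mktuple.
  by rewrite [linform a * _]mulrC mul_mpolyC subrK.
exists (c *: r + q).
rewrite {1}er {1}e comp_mpolyD comp_mpolyZ mulrDr -scalerAr scalerDr.
by rewrite addrACA.
Qed.

Lemma elim_linform b :
  linform b \mPo elim_tuple = linform (fun j => b j - b j0 / a j0 * a j).
Proof.
rewrite /linform raddf_sum /=.
under eq_bigr => j _.
  rewrite comp_mpolyZ comp_mpolyXU -tnth_nth tnth_mktuple scalerBr scalerA.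
over.
rewrite sumrB -scaler_suml [X in X *: _](bigD1 j0) //=.
rewrite [X in (_ + X) *: _]big1; last first.
  by move=> j /negPf->; rewrite mul0r mulr0.
rewrite eqxx addr0 mul1r scaler_sumr -sumrB; apply: eq_bigr => j _.
by rewrite scalerA -scalerBl.
Qed.

Lemma elim_eq0 p : p \mPo elim_tuple = 0 <-> exists q, p = linform a * q.
Proof.
split=> [p0 | [q ->]].
  by have [q] := elim_sub p; rewrite p0 add0r; exists q.
rewrite rmorphM /= elim_linform [X in X * _]big1 ?mul0r // => j _.
by rewrite divff // mul1r subrr scale0r.
Qed.

End Elimination.

Lemma row_neq0_ex (R : nzRingType) n l (A : 'M[R]_(n, l)) i :
  row i A != 0 -> exists j, A i j != 0.
Proof.
move=> nzA; apply/existsP; apply: contraR nzA; rewrite negb_exists.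
move=> /forallP A0; apply/eqP/rowP => j; rewrite !mxE; apply/eqP.
by have := A0 j; rewrite negbK.
Qed.

(** Divisibility by [alpha_i] becomes vanishing under a ring morphism into a domain, so primality of
    the forms comes for free. The second clause says that forms of distinct hyperplanes are coprime,
    since they are not proportional. *)
Lemma eliminators (K : fieldType) n l (A : 'M[K]_(n, l)) :
  is_arrangement A ->
  exists s : 'I_n -> {rmorphism {mpoly K[l]} -> {mpoly K[l]}},
    (forall i p, s i p = 0 <-> exists q, p = lform A i * q) /\
    (forall i j, i != j -> s i (lform A j) <> 0).
Proof.
case=> nzA ne_hyp.
have /fin_all_exists[pv pvP] : forall i, exists j, A i j != 0.
  by move=> i; apply/row_neq0_ex/nzA.
exists (fun i => comp_mpoly (elim_tuple (A i) (pv i)) : {rmorphism _ -> _}).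
split=> [i p | i j ne_ij] /=; first exact: elim_eq0.
rewrite elim_linform => /linform_eq0 eqA.
(* If the substitution kills the form of row [j], that row is [c] times row [i], and the two
   hyperplanes coincide. *)
set c := A j (pv i) / A i (pv i) in eqA.
have row_j : row j A = c *: row i A.
  by apply/rowP=> k; rewrite !mxE; apply/eqP; rewrite -subr_eq0 eqA.
have c0 : c != 0.
  by apply: contraNneq (nzA j) => c0; rewrite row_j c0 scale0r.
case/negP: (ne_hyp _ _ ne_ij); rewrite /hyp_space row_j linearZ /=.
apply/andP; split; apply/sub_kermxP.
  by rewrite -scalemxAr mulmx_ker scaler0.
have := mulmx_ker (c *: (row i A)^T); rewrite -scalemxAr => /eqP.
by rewrite scalemx_eq0 (negPf c0) => /eqP.
Qed.

(** * Saito's criterion *)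

(** As [msize] is the degree plus one, and 0 at the zero polynomial, [msize p <= a.+1] reads as
    degree at most [a], with zero allowed. *)
Lemma msizeM_leS (R : idomainType) l (p q : {mpoly R[l]}) a b :
  (msize p <= a.+1)%N -> (msize q <= b.+1)%N -> (msize (p * q) <= (a + b).+1)%N.
Proof.
have [-> | p0] := eqVneq p 0; first by rewrite mul0r msize0.
have [-> | q0] := eqVneq q 0; first by rewrite mulr0 msize0.
move=> sp sq; rewrite msizeM //; have := leq_add sp sq.
by rewrite addSn addnS; case: (_ + _)%N.
Qed.

Lemma msize_det_leS (R : idomainType) l r (M : 'M[{mpoly R[l]}]_r) d :
  (forall k j, msize (M k j) <= (d k).+1)%N ->
  (msize (\det M) <= (\sum_k d k).+1)%N.
Proof.
move=> szM; apply: leq_trans (msize_sum _ _ _) _.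
apply/bigmax_leqP => s _; rewrite mulr_sign.
suff szP : (msize (\prod_k M k (s k)) <= (\sum_k d k).+1)%N.
  by case: ifP => _; rewrite ?msizeN.
elim/big_ind2: _ => [|p1 d1 p2 d2|k _ //]; first by rewrite msize1.
exact: msizeM_leS.
Qed.

Lemma homog_msize_leS (R : nzRingType) l (p : {mpoly R[l]}) d :
  p \is d.-homog -> (msize p <= d.+1)%N.
Proof.
move=> /dhomogP hp; rewrite msizeE big_seq.
apply: (big_ind (fun x => x <= d.+1)%N).
- by [].
- by move=> x y lex ley; rewrite geq_max lex.
- by move=> m /hp ->.
Qed.

Lemma prod_homog (R : nzRingType) l (I : Type) (r : seq I)
    (F : I -> {mpoly R[l]}) d :
  (forall i, F i \is (d i).-homog) ->
  \prod_(i <- r) F i \is (\sum_(i <- r) d i).-homog.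
Proof.
move=> hF; elim/big_ind2: _ => [|p1 d1 p2 d2|i _ //]; first exact: dhomog1.
exact: dhomogM.
Qed.

Lemma det_homog (R : comNzRingType) l r (M : 'M[{mpoly R[l]}]_r) d :
  (forall k j, M k j \is (d k).-homog) -> \det M \is (\sum_k d k).-homog.
Proof.
move=> hM; apply: rpred_sum => s _; rewrite mulr_sign.
by case: ifP => _; rewrite ?rpredN; apply: prod_homog.
Qed.

(** Multilinearity in the rows: the summand used in row [k] is chosen independently as [f k]. *)
Lemma det_sum_rows (R : comNzRingType) r (T : finType) (F : T -> 'M[R]_r) :
  \det (\sum_t F t) =
    \sum_(f : {ffun 'I_r -> T}) \det (\matrix_(k, j) F (f k) k j).
Proof.
rewrite /determinant exchange_big; apply: eq_bigr => s _ /=.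
rewrite -big_distrr /=; congr (_ * _).
under eq_bigr => k _ do rewrite summxE.
rewrite bigA_distr_bigA /=; apply: eq_bigr => f _.
by apply: eq_bigr => k _; rewrite mxE.
Qed.

(** Over the fraction field [q%:M] has rank [r], while a product through dimension [m] has rank at
    most [m]. *)
Lemma factor_scalar_mx_leq (R : idomainType) r m (C : 'M[R]_(r, m))
    (B : 'M_(m, r)) q :
  q != 0 -> C *m B = q%:M -> (r <= m)%N.
Proof.
move=> q0 /(congr1 (map_mx (@tofrac R))); rewrite map_mxM map_scalar_mx /=.
move=> /(congr1 (fun M => \rank M)) eqr.
have := mulmx_max_rank (map_mx (@tofrac R) C) (map_mx (@tofrac R) B).
by rewrite eqr -scalemx1 mxrank_scale_nz ?mxrank1 // tofrac_eq0.
Qed.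

(** * Determinants of logarithmic fields *)

Section Saito.
Variables (K : fieldType) (n l : nat) (A : 'M[K]_(n, l)).
Local Notation S := {mpoly K[l]}.
Local Notation alpha i := (lform A i).

Definition defpoly : S := \prod_(i < n) alpha i.

(** Degree bounds replace homogeneity: the determinant is a multiple of [defpoly], of degree [n], so
    a total degree of at most [n] forces a constant multiple. Only finitely many coefficients are
    involved, which suits reduction and lifting. *)
Definition saito : Prop :=
  exists (d : 'I_l -> nat) (M : 'M[S]_l),
    [/\ (\sum_k d k <= n)%N, forall k, in_logder A (M k),
        forall k j, (msize (M k j) <= (d k).+1)%N & \det M != 0].

Hypothesis arrA : is_arrangement A.

Variable s : 'I_n -> {rmorphism S -> S}.
Hypothesis sP : forall i p, s i p = 0 <-> exists q, p = alpha i * q.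
Hypothesis s_neq0 : forall i j, i != j -> s i (alpha j) <> 0.

Lemma lform_neq0 i : alpha i != 0.
Proof.
apply/eqP => /linform_eq0 a0; case/negP: (arrA.1 i).
by apply/eqP/rowP => j; rewrite !mxE a0.
Qed.

Lemma defpoly_neq0 : defpoly != 0.
Proof. by apply/prodf_neq0 => i _; apply: lform_neq0. Qed.

Lemma defpoly_homog : defpoly \is n.-homog.
Proof.
rewrite -[X in X.-homog]card_ord -sum1_card.
by apply: prod_homog => i; apply: linform_homog.
Qed.

(** The forms are pairwise coprime primes: they are split off one at a time, as [s i] kills none of
    the others. *)
Lemma defpoly_dvd p : (forall i, s i p = 0) -> exists q, p = defpoly * q.
Proof.
move=> sp0; rewrite /defpoly; have := index_enum_uniq 'I_n.
elim: (index_enum _) => [|i r IHr] /=.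
  by move=> _; exists p; rewrite big_nil mul1r.
case/andP=> ir /IHr[q def_p]; have := sp0 i; rewrite {1}def_p rmorphM /=.
move/eqP; rewrite mulf_eq0 rmorph_prod prodf_seq_eq0.
case/orP=> [/hasP[j jr /= sj]|].
  case: (@s_neq0 i j); last exact/eqP.
  by apply: contraNneq ir => ->.
move/eqP/sP=> [q' def_q]; exists q'.
by rewrite def_p def_q big_cons mulrA [X in X * _]mulrC.
Qed.

Lemma dvd_defpoly_cancel g h x :
  (forall i, s i g != 0) -> g * h = defpoly * x -> exists h', g * h' = x.
Proof.
move=> sg; rewrite /defpoly; elim: (index_enum _) h => [|i r IHr] h.
  by rewrite big_nil mul1r; exists h.
rewrite big_cons -mulrA => def_gh.
have /eqP: s i (g * h) = 0 by apply/sP; exists (\prod_(j <- r) alpha j * x).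
rewrite rmorphM mulf_eq0 (negPf (sg i)) /= => /eqP/sP[h' def_h].
apply: (IHr h'); apply: (mulfI (lform_neq0 i)).
by rewrite -def_gh def_h mulrCA.
Qed.

(** Being prime to every [alpha i], [g] can be cancelled against the factors [defpoly] one by one
    until it divides 1. *)
Lemma msize_dvd_defpolyX g h k :
  (forall i, s i g != 0) -> g * h = defpoly ^+ k -> msize g = 1%N.
Proof.
move=> sg; elim: k h => [|k IHk] h; last first.
  by rewrite exprS => /(dvd_defpoly_cancel sg)[h']; apply: IHk.
rewrite expr0 => gh1.
have g0 : g != 0.
  by apply/eqP => g0; move/eqP: gh1; rewrite g0 mul0r eq_sym oner_eq0.
have h0 : h != 0.
  by apply/eqP => h0; move/eqP: gh1; rewrite h0 mulr0 eq_sym oner_eq0.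
have := congr1 (fun p => msize p) gh1; rewrite msizeM // msize1.
have: msize g != 0%N by rewrite msize_poly_eq0.
have: msize h != 0%N by rewrite msize_poly_eq0.
by case: (msize g) (msize h) => [|[|a]] [|b] //; rewrite ?addSn ?addnS.
Qed.

Lemma logderP (f : 'I_l -> S) :
  in_logder A f <-> forall i, s i (\sum_(j < l) A i j *: f j) = 0.
Proof.
split=> logf i; last by rewrite der_app_lform; apply/sP.
by apply/sP; rewrite -der_app_lform; apply: logf.
Qed.

(** Modulo [alpha i] the matrix kills the nonzero coefficient vector of [alpha i], hence is
    singular; multiplying by the adjugate makes this explicit. *)
Lemma det_log (M : 'M[S]_l) :
  (forall k, in_logder A (M k)) -> exists q, \det M = defpoly * q.
Proof.
move=> logM; apply: defpoly_dvd => i.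
have [j0 Aij0] := row_neq0_ex (arrA.1 i).
pose a : 'cV[S]_l := \col_j (A i j)%:MP.
have sMa k : s i ((M *m a) k 0) = 0.
  rewrite mxE -[RHS]((logderP _).1 (logM k) i); congr (s i _).
  by apply: eq_bigr => j _; rewrite mxE mulrC mul_mpolyC.
have: s i ((\adj M *m (M *m a)) j0 0) = 0.
  by rewrite mxE rmorph_sum big1 // => k _; rewrite rmorphM /= sMa mulr0.
rewrite mulmxA mul_adj_mx mul_scalar_mx !mxE => /sP[q].
rewrite mulrC mul_mpolyC => def_q; apply/sP; exists ((A i j0)^-1 *: q).
by rewrite -scalerAr -def_q scalerA mulVf // scale1r.
Qed.

(** By Cramer's rule the sum is the determinant of [M] with row [k] replaced by [f], whose rows are
    still logarithmic. *)
Lemma adj_log (M : 'M[S]_l) (f : 'I_l -> S) k :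
  (forall k, in_logder A (M k)) -> in_logder A f ->
  exists q, \sum_j f j * \adj M j k = defpoly * q.
Proof.
move=> logM logf; pose M' := \matrix_(k', j) if k' == k then f j else M k' j.
have [k'|q det_M'] := @det_log M'.
  apply/logderP => i; have [eq_k|ne_k] := eqVneq k' k.
    rewrite -[RHS]((logderP _).1 logf i); congr (s i _); apply: eq_bigr => j _.
    by rewrite mxE eq_k eqxx.
  rewrite -[RHS]((logderP _).1 (logM k') i); congr (s i _).
  by apply: eq_bigr => j _; rewrite mxE (negPf ne_k).
exists q; rewrite -det_M' (expand_det_row _ k); apply: eq_bigr => j _.
rewrite !mxE eqxx; congr (_ * (_ * \det _)); apply/matrixP => u v.
by rewrite !mxE eq_sym (negPf (neq_lift _ _)).
Qed.

Lemma saito_free : saito -> free_arr A.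
Proof.
case=> d [M [sum_d logM szM detM0]].
have [g det_g] := det_log logM.
have g0 : g != 0 by apply: contraNneq detM0 => g0; rewrite det_g g0 mulr0.
have szQ : msize defpoly = n.+1.
  rewrite -(mlead_deg defpoly_neq0).
  by rewrite (dhomog_mf defpoly_homog) ?mlead_supp ?defpoly_neq0.
(* Degree count: [defpoly * g] has degree at most [n], which [defpoly] already attains. *)
have /eqP/msize_poly1P[c c0 def_g] : msize g = 1%N.
  have: (msize (\det M) <= n.+1)%N by apply: leq_trans (msize_det_leS szM) _.
  rewrite det_g msizeM ?defpoly_neq0 // szQ addSn /= -addn1 leq_add2l => le1.
  by apply/eqP; rewrite eqn_leq le1 lt0n msize_poly_eq0.
have det_dvd p : (exists q, p = defpoly * q) -> exists q, p = \det M * q.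
  case=> q ->; exists (c^-1 *: q); rewrite det_g def_g -mulrA mul_mpolyC.
  by rewrite scalerA divff // scale1r.
exists l, (fun k => M k); split=> // [f logf | c' c'0 k].
  have /fin_all_exists[r rP] : forall k, exists q,
      \sum_j f j * \adj M j k = \det M * q.
    by move=> k; apply/det_dvd/adj_log.
  (* After multiplication by [\det M], the expansion of [f] is the identity
     [f * \adj M * M = \det M * f]. *)
  exists r => j; apply: (mulfI detM0).
  rewrite big_distrr /=; under eq_bigr => k _ do rewrite mulrA -rP.
  have := congr1 (fun B : 'rV_l => B 0 j)
    (mulmxA (\row_j f j) (\adj M) M).
  rewrite mul_adj_mx mul_mx_scalar !mxE => ->; apply: eq_bigr => k _.
  by congr (_ * _); rewrite mxE; apply: eq_bigr => u _; rewrite mxE.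
have := congr1 (fun B : 'rV_l => B 0 k) (mulmxA (\row_k c' k) M (\adj M)).
rewrite mul_mx_adj mul_mx_scalar !mxE big1 => [/eqP|u _].
  by rewrite mulf_eq0 (negPf detM0) => /eqP.
rewrite mxE [X in X * _](_ : _ = 0) ?mul0r // -[RHS](c'0 u).
by apply: eq_bigr => v _; rewrite mxE.
Qed.

(** * Homogeneous components of logarithmic fields *)

(** Since [alpha i] is homogeneous of degree 1, multiplying by it only shifts the components of
    [q]. *)
Lemma pihomog_lform_dvd i e q :
  exists q', pihomog mdeg e (alpha i * q) = alpha i * q'.
Proof.
rewrite {1}(pihomog_partitionE (leqnn (msize q))) big_distrr raddf_sum /=.
apply: (big_ind (fun x => exists q', x = alpha i * q')).
- by exists 0; rewrite mulr0.
- by move=> _ _ [q1 ->] [q2 ->]; exists (q1 + q2); rewrite mulrDr.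
move=> d _; have homd : alpha i * pihomog mdeg d q \is (1 + d).-homog.
  by apply: dhomogM; [apply: linform_homog | apply: pihomogP].
have [<- | ne_de] := eqVneq (1 + d)%N e.
  by rewrite pihomog_dE //; exists (pihomog mdeg d q).
by rewrite (pihomog_ne0 ne_de homd); exists 0; rewrite mulr0.
Qed.

Lemma pihomog_log f e :
  in_logder A f -> in_logder A (fun j => pihomog mdeg e (f j)).
Proof.
move=> logf i; have [q def_q] := logf i.
have [q' def_q'] := pihomog_lform_dvd i e q.
exists q'; rewrite -def_q' -def_q !der_app_lform raddf_sum /=.
by apply: eq_bigr => j _; rewrite linearZ.
Qed.

(* Expand the determinant by multilinearity over the homogeneous components of
   the rows, and keep a family contributing to the coefficient of [m]. *)
Lemma homog_rows (B : 'M[S]_l) m :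
  (forall k, in_logder A (B k)) -> m \in msupp (\det B) -> (mdeg m <= n)%N ->
  saito.
Proof.
move=> logB mB le_mn; pose D := (\max_k \max_j msize (B k j))%N.
pose F (e : 'I_D) : 'M[S]_l := \matrix_(k, j) pihomog mdeg e (B k j).
have def_B : B = \sum_e F e.
  apply/matrixP => k j; rewrite summxE.
  under eq_bigr => e _ do rewrite mxE.
  apply: pihomog_partitionE.
  by apply: leq_trans (leq_bigmax k); apply: (leq_bigmax j).
move: mB; rewrite mcoeff_msupp def_B det_sum_rows raddf_sum /= => nz_sum.
have [f nz_f] : exists f : {ffun 'I_l -> 'I_D},
    (\det (\matrix_(k, j) F (f k) k j))@_m != 0.
  apply/existsP; apply: contraR nz_sum; rewrite negb_exists => /forallP z.
  by rewrite big1 // => f _; apply/eqP; have := z f; rewrite negbK.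
have homM k j : (\matrix_(k, j) F (f k) k j) k j \is (f k).-homog.
  by rewrite !mxE pihomogP.
exists (fun k => f k), (\matrix_(k, j) F (f k) k j); split.
(* The chosen determinant is homogeneous and contains [m], so the row degrees add up to [mdeg m]. *)
- by rewrite -(dhomog_mf (det_homog homM) (x := m)) ?mcoeff_msupp.
- move=> k i; have [q def_q] := pihomog_log (f k) (logB k) i.
  exists q; rewrite -def_q !der_app_lform; apply: eq_bigr => j _.
  by rewrite !mxE.
- by move=> k j; apply/homog_msize_leS/homM.
by apply: contraNneq nz_f => ->; rewrite mcoeff0.
Qed.

(** * From a free basis to Saito's criterion *)

Lemma log_mull i (u : S) (r : 'I_l -> S) :
  s i u = 0 -> s i (\sum_j A i j *: (u * r j)) = 0.
Proof.
move=> su; under eq_bigr => j _ do rewrite scalerAr.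
by rewrite -big_distrr rmorphM /= su mul0r.
Qed.

Lemma defpoly_sieve i : s i defpoly = 0.
Proof.
apply/sP; exists (\prod_(j < n | j != i) alpha j).
by rewrite /defpoly (bigD1 i).
Qed.

(* If [C] expresses the fields [Q d/dx_j] in the basis [B], then [C *m B] and
   [B *m C] are both the scalar matrix [Q], so [B] is square. *)
Lemma free_basis : free_arr A ->
  exists B : 'M[S]_l, (forall k, in_logder A (B k)) /\
    forall N : 'M[S]_l, (forall k, in_logder A (N k)) -> exists C, N = C *m B.
Proof.
case=> m [b [logb genb freeb]]; pose B : 'M[S]_(m, l) := \matrix_(k, j) b k j.
have genB r (N : 'M[S]_(r, l)) : (forall k, in_logder A (N k)) ->
    exists C, N = C *m B.
  move=> logN; have /fin_all_exists[c cP] := fun k => genb _ (logN k).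
  exists (\matrix_(k, t) c k t); apply/matrixP => k j; rewrite cP mxE.
  by apply: eq_bigr => t _; rewrite !mxE.
have freeB r (C : 'M[S]_(r, m)) : C *m B = 0 -> C = 0.
  move=> CB0; apply/matrixP => k t; rewrite [RHS]mxE.
  apply: (freeb (C k)) => j; have := congr1 (fun M : 'M_(r, l) => M k j) CB0.
  rewrite !mxE => CB0j; rewrite -[RHS]CB0j.
  by apply: eq_bigr => u _; rewrite mxE.
have [k|C def_C] := genB l defpoly%:M.
  apply/logderP => i; under eq_bigr => j _ do rewrite mxE -mulr_natr.
  exact/log_mull/defpoly_sieve.
have BC : B *m C = defpoly%:M.
  apply/eqP; rewrite -subr_eq0; apply/eqP; apply: freeB.
  by rewrite mulmxBl -mulmxA -def_C mul_mx_scalar mul_scalar_mx subrr.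
have eq_ml : m = l.
  apply/eqP; rewrite eqn_leq (factor_scalar_mx_leq defpoly_neq0 BC).
  by rewrite (factor_scalar_mx_leq defpoly_neq0 (esym def_C)).
move: b logb @B genB {genb freeb freeB C def_C BC}.
rewrite eq_ml => b logb B genB.
exists B; split=> [k i|N]; last exact: genB.
have [q def_q] := logb k i; exists q; rewrite -def_q.
by rewrite !der_app_lform; apply: eq_bigr => j _; rewrite mxE.
Qed.

(** Provides logarithmic fields whose determinant contains [alpha i] only once. Row [j0] is
    [Q d/dx_j0]; every other row is a derivation killing [alpha i], multiplied by the product [u] of
    the other forms. *)
Lemma log_diag_det i (j0 : 'I_l) : A i j0 != 0 ->
  exists N : 'M[S]_l, (forall k, in_logder A (N k)) /\
    \det N = defpoly * (\prod_(j < n | j != i) alpha j) ^+ l.-1.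
Proof.
move=> Aij0; set u := \prod_(j < n | _) _.
pose N : 'M[S]_l := \matrix_(k, j)
  if k == j0 then defpoly * (j == j0)%:R
  else u * ((k == j)%:R - (A i k / A i j0 * (j == j0)%:R)%:MP).
exists N; split.
  move=> k; apply/logderP => i'.
  under eq_bigr => j _ do rewrite mxE.
  have [eq_k | ne_k] := eqVneq k j0; first exact/log_mull/defpoly_sieve.
  have [eq_i | ne_i] := eqVneq i' i; last first.
    by apply/log_mull/sP; rewrite /u (bigD1 i') //=; eexists.
  rewrite eq_i [X in s i X](_ : _ = 0) ?rmorph0 //.
  under eq_bigr => j _ do rewrite scalerAr.
  rewrite -big_distrr /= (_ : \sum_j _ = 0) ?mulr0 //.
  under eq_bigr => j _ do rewrite -mul_mpolyC mulrBr -mpolyCM.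
  rewrite sumrB (bigD1 k) //= eqxx mulr1 big1 ?addr0 => [|j /negPf ne_j].
    rewrite (bigD1 j0) //= eqxx mulr1 big1 ?addr0 => [|j /negPf->].
      by rewrite mulrC divfK // subrr.
    by rewrite !mulr0.
  by rewrite eq_sym ne_j mulr0.
rewrite (expand_det_row _ j0) (bigD1 j0) //= big1 ?addr0 => [|j /negPf ne_j].
  rewrite mxE !eqxx mulr1 /cofactor -signr_odd addnn odd_double expr0 mul1r.
  rewrite (_ : row' _ _ = u%:M) ?det_scalar //.
  apply/matrixP => k j; rewrite !mxE eq_sym (negPf (neq_lift _ _)).
  rewrite (eq_sym _ j0) (negPf (neq_lift _ _)) mulr0 mpolyC0 subr0.
  by rewrite (inj_eq lift_inj) mulr_natr.
by rewrite mxE eqxx ne_j mulr0 mul0r.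
Qed.

(* Writing [\det B = Q * g] for a basis [B], expressing the fields [Q d/dx_j] in
   the basis shows that [g] divides [Q ^+ l]; the fields of [log_diag_det] show
   that no [alpha i] divides [g], so [g] is constant. *)
Lemma free_saito : free_arr A -> saito.
Proof.
case/free_basis=> B [logB genB]; have [g det_g] := det_log logB.
have [k|C def_C] := genB defpoly%:M.
  apply/logderP => i; under eq_bigr => j _ do rewrite mxE -mulr_natr.
  exact/log_mull/defpoly_sieve.
have gh : g * (defpoly * \det C) = defpoly ^+ l.
  by rewrite -det_scalar def_C det_mulmx det_g mulrCA [g * _]mulrC mulrCA.
have sg i : s i g != 0.
  have [j0 Aij0] := row_neq0_ex (arrA.1 i).
  have [N [logN detN]] := log_diag_det Aij0; have [C' def_N] := genB N logN.
  apply/eqP => sg0; move: detN; rewrite def_N det_mulmx det_g mulrCA.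
  move/(mulfI defpoly_neq0)/(congr1 (s i)); rewrite rmorphM /= sg0 mulr0.
  rewrite rmorphXn rmorph_prod => /esym/eqP; apply/negP; rewrite expf_neq0 //.
  by apply/prodf_neq0 => j ne_ji; apply/eqP; apply: s_neq0; rewrite eq_sym.
have g1 := msize_dvd_defpolyX sg gh.
have g0 : g != 0 by rewrite -msize_poly_eq0 g1.
have det0 : \det B != 0 by rewrite det_g mulf_neq0 ?defpoly_neq0.
apply: (homog_rows logB (mlead_supp det0)).
(* With [g] constant, [\det B] has degree at most [n], so its leading monomial is admissible for
   [homog_rows]. *)
rewrite -ltnS mlead_deg // det_g msizeM ?defpoly_neq0 // g1 addn1.
exact: (homog_msize_leS defpoly_homog).
Qed.

End Saito.

(** * Reduction of integer linear systems modulo large primes *)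

Definition almost_all_primes (P : nat -> Prop) : Prop :=
  exists N, forall p, prime p -> (N < p)%N -> P p.

Lemma almost_all_primes_and P1 P2 :
  almost_all_primes P1 -> almost_all_primes P2 ->
  almost_all_primes (fun p => P1 p /\ P2 p).
Proof.
move=> [N1 P1P] [N2 P2P]; exists (maxn N1 N2) => p pr_p.
by rewrite gtn_max => /andP[lt1 lt2]; split; [apply: P1P | apply: P2P].
Qed.

Lemma almost_all_primes_forall (T : finType) (P : T -> nat -> Prop) :
  (forall t, almost_all_primes (P t)) ->
  almost_all_primes (fun p => forall t, P t p).
Proof.
move=> /fin_all_exists[N NP]; exists (\max_t N t)%N => p pr_p ltp t.
by apply: NP => //; apply: leq_ltn_trans ltp; apply: leq_bigmax.
Qed.

Lemma almost_all_primes_ex P :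
  almost_all_primes P -> exists2 p, prime p & P p.
Proof.
move=> [N NP]; have [p ltNp pr_p] := prime_above N.
by exists p => //; apply: NP.
Qed.

Lemma intr_Fp_neq0 (z : int) : z != 0 ->
  almost_all_primes (fun p => z%:~R != 0 :> 'F_p).
Proof.
move=> z0; exists `|z|%N => p pr_p ltzp.
suff: (`|z|%N)%:R != 0 :> 'F_p.
  rewrite [z in z%:~R]intEsign rmorphMsign mulr_sign.
  by case: ifP; rewrite ?oppr_eq0.
by rewrite -(dvdn_pcharf (pchar_Fp pr_p)) gtnNdvd // lt0n absz_eq0.
Qed.

Lemma nth_Fp_neq0 m (d : seq int) :
  almost_all_primes
    (fun p => forall i : 'I_m, d`_i != 0 -> (d`_i)%:~R != 0 :> 'F_p).
Proof.
apply: almost_all_primes_forall => i.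
have [d0 | d0] := eqVneq d`_i 0; first by exists 0%N.
by have [N NP] := intr_Fp_neq0 d0; exists N => p ? ? _; apply: NP.
Qed.

(** * Smith normal form modulo a prime *)

Definition smith_mx m n (d : seq int) : 'M[int]_(m, n) :=
  \matrix_(i, j) (d`_i *+ (i == j :> nat)).

(** Zero divides only zero, so the zeros of a divisibility chain form a tail, continued past the end
    by the default value of [nth]. *)
Lemma sorted_dvdz_zeros (d : seq int) :
  sorted dvdz d ->
  forall i, (d`_i == 0) = (find (pred1 (0 : int)) d <= i)%N.
Proof.
move=> sd i; have [le_i | lt_i] := leqP; last first.
  by apply/negP; have := before_find 0 lt_i => /= ->.
have [lt_id | ?] := ltnP i (size d); last by rewrite nth_default.
have lt_fd := leq_ltn_trans le_i lt_id.
have hd : has (pred1 (0 : int)) d by rewrite has_find.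
have d0 := nth_find 0 hd; rewrite /= in d0.
have tr : transitive dvdz by move=> x y z; apply: dvdz_trans.
have := sorted_leq_nth tr dvdzz 0 sd _ _ lt_fd lt_id le_i.
by rewrite (eqP d0) => d0i; rewrite -dvd0z.
Qed.

Lemma rank_smith_mx (F : fieldType) m n (d : seq int) :
  sorted dvdz d -> (forall i : 'I_m, d`_i != 0 -> (d`_i)%:~R != 0 :> F) ->
  \rank (map_mx intr (smith_mx m n d) : 'M[F]_(m, n)) =
    minn m (minn n (find (pred1 (0 : int)) d)).
Proof.
move=> sd dF; set r := find _ _.
(* Zero invariant factors are replaced by 1, so that the diagonal factor is invertible and
   [pid_mx r] alone carries the rank. *)
pose e : 'rV[F]_m := \row_i (if (i < r)%N then (d`_i)%:~R else 1).
have -> : map_mx intr (smith_mx m n d) = diag_mx e *m pid_mx r :> 'M[F]_(m, n).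
  apply/matrixP => i j; rewrite mul_diag_mx !mxE rmorphMn /=.
  have [lt_ir | le_ri] := ltnP i r; first by rewrite andbT mulr_natr.
  have: d`_i == 0 by rewrite sorted_dvdz_zeros.
  by rewrite andbF mulr0 => /eqP->; rewrite mul0rn.
have e_unit : diag_mx e \in unitmx.
  rewrite unitmxE det_diag unitfE; apply/prodf_neq0 => i _; rewrite mxE.
  case: ltnP => [lt_ir | _]; last exact: oner_neq0.
  by apply: dF; rewrite sorted_dvdz_zeros // -ltnNge.
rewrite eqmxMfull; last by rewrite row_full_unit.
rewrite -pid_mx_minh -pid_mx_minv rank_pid_mx ?geq_minl //.
by rewrite (leq_trans (geq_minr _ _)) ?geq_minl.
Qed.

Lemma map_intr_unitmx (F : fieldType) m (L : 'M[int]_m) :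
  L \in unitmx -> (map_mx intr L : 'M[F]_m) \in unitmx.
Proof. by rewrite !unitmxE det_map_mx; apply: rmorph_unit. Qed.

Lemma rank_map_unit (F : fieldType) m n (L : 'M[int]_m) (D : 'M_(m, n)) R :
  L \in unitmx -> R \in unitmx ->
  \rank (map_mx intr (L *m D *m R) : 'M[F]_(m, n)) =
  \rank (map_mx intr D : 'M[F]_(m, n)).
Proof.
move=> uL uR; rewrite !map_mxM mxrankMfree; last first.
  by rewrite row_free_unit map_intr_unitmx.
by rewrite eqmxMfull // row_full_unit map_intr_unitmx.
Qed.

(** Unimodular factors stay invertible over every field, and the nonzero invariant factors stay
    nonzero modulo large primes. *)
Lemma rank_mod_p m n (M : 'M[int]_(m, n)) :
  almost_all_primes (fun p => \rank (map_mx intr M : 'M['F_p]_(m, n)) =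
                              \rank (map_mx intr M : 'M[rat]_(m, n))).
Proof.
have [L uL [R uR [d sd ->]]] := int_Smith_normal_form M.
have [N NP] := nth_Fp_neq0 m d; exists N => p pr_p ltp.
rewrite !rank_map_unit // !rank_smith_mx // => [i|]; last exact: NP.
by rewrite intr_eq0.
Qed.

(** In Smith coordinates the kernel is a coordinate subspace, cut out by the same coordinates over
    the integers and modulo a large prime. *)
Lemma kernel_lift m n (M : 'M[int]_(m, n)) :
  almost_all_primes (fun p => forall x : 'rV['F_p]_m,
    x *m map_mx intr M = 0 ->
    exists2 X : 'rV[int]_m, X *m M = 0 & map_mx intr X = x).
Proof.
have [L uL [R uR [d sd ->]]] := int_Smith_normal_form M.
rewrite -/(smith_mx m n d).
have [N NP] := nth_Fp_neq0 m d; exists N => p pr_p ltp x.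
have {NP} dF := NP p pr_p ltp.
rewrite !map_mxM !mulmxA => xLDR.
have [y def_y] : exists y, y = x *m map_mx intr L by eexists.
have yD : y *m map_mx intr (smith_mx m n d) = 0.
  have uR' : map_mx intr R \in (unitmx : pred 'M['F_p]_n)
    by rewrite map_intr_unitmx.
  by apply: (can_inj (mulmxK uR')); rewrite mul0mx def_y.
have y0 (i : 'I_m) : (i < n)%N -> d`_i != 0 -> y 0 i = 0.
  move=> lt_in d0; have := congr1 (fun B : 'rV_n => B 0 (Ordinal lt_in)) yD.
  rewrite !mxE (bigD1 i) //= big1 ?addr0 => [|k ne_ki].
    rewrite !mxE eqxx mulr1n => /eqP; rewrite mulf_eq0.
    by rewrite (negPf (dF i d0)) orbF => /eqP.
  by rewrite !mxE -val_eqE /= in ne_ki *; rewrite (negPf ne_ki) mulr0n mulr0.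
(* Constrained coordinates, where [y] vanishes, lift to exactly 0; the free ones lift to any
   representative. *)
pose Y : 'rV[int]_m :=
  \row_i (if (i < n)%N && (d`_i != 0) then 0 else (val (y 0 i))%:Z).
have YD : Y *m smith_mx m n d = 0.
  apply/rowP => j; rewrite !mxE big1 // => i _; rewrite !mxE.
  have [eq_ij | _] := eqVneq (i : nat) j; last by rewrite mulr0n mulr0.
  rewrite mulr1n eq_ij ltn_ord /=.
  by case: eqVneq => [->|_]; rewrite ?mulr0 ?mul0r.
have Yy : map_mx intr Y = y.
  apply/rowP => i; rewrite !mxE; case: ifP => [/andP[lt_in d0]|_].
    by rewrite rmorph0 y0.
  by rewrite -pmulrn natr_Zp.
exists (Y *m invmx L); first by rewrite !mulmxA mulmxKV // YD mul0mx.
by rewrite map_mxM Yy def_y -mulmxA -map_mxM mulmxV // map_mx1 mulmx1.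
Qed.

Lemma system_lift (T I : finType) (a : T -> I -> int) :
  almost_all_primes (fun p => forall x : T -> 'F_p,
    (forall i, \sum_t x t * (a t i)%:~R = 0) ->
    exists2 X : T -> int, forall i, \sum_t X t * a t i = 0 &
      forall t, (X t)%:~R = x t).
Proof.
pose M := \matrix_(t < #|T|, i < #|I|) a (enum_val t) (enum_val i).
have [N NP] := kernel_lift M; exists N => p pr_p ltp x xa.
have [|X XM Xx] := NP p pr_p ltp (\row_t x (enum_val t)).
  apply/rowP => i; rewrite !mxE -[RHS](xa (enum_val i)) [RHS]big_enum_val /=.
  by apply: eq_bigr => t _; rewrite !mxE.
exists (fun t => X 0 (enum_rank t)) => [i|t].
  have := congr1 (fun B : 'rV_#|I| => B 0 (enum_rank i)) XM.
  rewrite !mxE => XMi; rewrite -[RHS]XMi [LHS]big_enum_val /=.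
  by apply: eq_bigr => t _; rewrite !mxE enum_valK enum_rankK.
have := congr1 (fun B : 'rV_#|T| => B 0 (enum_rank t)) Xx.
by rewrite !mxE enum_rankK.
Qed.

(** Comparing coefficients gives one scalar equation per index and monomial of degree below [D]; all
    higher coefficients vanish. *)
Lemma mpoly_system_lift l (T I : finType) (P : T -> I -> {mpoly int[l]}) :
  almost_all_primes (fun p => forall x : T -> 'F_p,
    (forall i, \sum_t x t *: map_mpoly intr (P t i) = 0) ->
    exists2 X : T -> int, forall i, \sum_t X t *: P t i = 0 &
      forall t, (X t)%:~R = x t).
Proof.
pose D := (\max_t \max_i msize (P t i))%N.
pose a t (im : I * 'X_{1..l < D}) := (P t im.1)@_im.2.
have [N NP] := system_lift a; exists N => p pr_p ltp x xP.
have [[i m] | X Xa Xx] := NP p pr_p ltp x.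
  rewrite -[RHS](@mcoeff0 l _ (val m)) -(xP i) raddf_sum /=.
  by apply: eq_bigr => t _; rewrite mcoeffZ mcoeff_map_mpoly.
exists X => // i; apply/mpolyP => m; rewrite raddf_sum mcoeff0 /=.
have [lt_mD | le_Dm] := ltnP (mdeg m) D.
  rewrite -[RHS](Xa (i, BMultinom lt_mD)); apply: eq_bigr => t _.
  by rewrite mcoeffZ.
rewrite big1 // => t _; rewrite mcoeffZ memN_msupp_eq0 ?mulr0 //.
apply: msize_mdeg_ge; apply: leq_trans le_Dm.
by apply: leq_trans (leq_bigmax t); apply: (leq_bigmax i).
Qed.

(** * Transfer between characteristic zero and large characteristic *)

Lemma map_mpoly_linform (R S : comNzRingType) (f : {rmorphism R -> S}) l
    (a : 'I_l -> R) :
  map_mpoly f (linform a) = linform (f \o a).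
Proof.
rewrite raddf_sum; apply: eq_bigr => j _ /=.
by rewrite map_mpolyZ map_mpolyX.
Qed.

Lemma msize_map_mpoly (R S : nzRingType) (f : {rmorphism R -> S}) l
    (p : {mpoly R[l]}) :
  (msize (map_mpoly f p) <= msize p)%N.
Proof.
rewrite [X in (X <= _)%N]msizeE; apply/bigmax_leqP_seq => m + _.
rewrite mcoeff_msupp mcoeff_map_mpoly => fpm; apply: msize_mdeg_lt.
by rewrite mcoeff_msupp; apply: contraNneq fpm => ->; rewrite raddf0.
Qed.

Lemma map_mpoly_intr_inj l :
  injective (map_mpoly intr : {mpoly int[l]} -> {mpoly rat[l]}).
Proof.
move=> p q /mpolyP pq; apply/mpolyP => m; have := pq m.
by rewrite !mcoeff_map_mpoly => /intr_inj.
Qed.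

Lemma map_mpoly_Fp_neq0 l (p : {mpoly int[l]}) : p != 0 ->
  almost_all_primes (fun q => map_mpoly intr p != 0 :> {mpoly 'F_q[l]}).
Proof.
move=> p0; have [|N NP] := @intr_Fp_neq0 (p@_(mlead p)).
  by rewrite -mcoeff_msupp mlead_supp.
exists N => q pr_q ltq; apply: contraNneq (NP q pr_q ltq) => p_eq0.
by rewrite -mcoeff_map_mpoly p_eq0 mcoeff0.
Qed.

(** * Logarithmic fields as solutions of an integer linear system *)

Section LogSystem.
Variables (n l e : nat) (AZ : 'M[int]_(n, l)).

(* Unknowns: the coefficients of the components [f_j] ([inl j]) and of the
   quotients [q_i] ([inr i]); equations:
   [\sum_j A i j *: f_j = alpha_i * q_i]. *)
Definition log_index : Type := (('I_l + 'I_n) * 'X_{1..l < e.+1})%type.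

Definition log_eqn (t : log_index) (i : 'I_n) : {mpoly int[l]} :=
  match t.1 with
  | inl j => AZ i j *: 'X_[t.2]
  | inr i' => if i' == i then - (linform (AZ i) * 'X_[t.2]) else 0
  end.

Definition trunc_poly (R : nzRingType) (x : log_index -> R) u : {mpoly R[l]} :=
  \sum_(m : 'X_{1..l < e.+1}) x (u, m) *: 'X_[m].

Lemma msize_trunc_poly (R : nzRingType) (x : log_index -> R) u :
  (msize (trunc_poly x u) <= e.+1)%N.
Proof.
apply: leq_trans (msize_sum _ _ _) _; apply/bigmax_leqP => m _.
by apply: leq_trans (msizeZ_le _ _) _; rewrite msizeX bmdeg.
Qed.

Lemma log_eqnE (R : comNzRingType) (x : log_index -> R) i :
  \sum_t x t *: map_mpoly intr (log_eqn t i) =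
    \sum_j (AZ i j)%:~R *: trunc_poly x (inl j) -
    linform (fun j => (AZ i j)%:~R) * trunc_poly x (inr i).
Proof.
transitivity (\sum_u \sum_m x (u, m) *: map_mpoly intr (log_eqn (u, m) i)).
  by rewrite pair_bigA; apply: eq_bigr => -[u m] _.
rewrite big_sumType /=; congr (_ + _).
  apply: eq_bigr => j _; rewrite scaler_sumr; apply: eq_bigr => m _.
  by rewrite map_mpolyZ map_mpolyX !scalerA mulrC.
rewrite (bigD1 i) //= [X in _ + X]big1 ?addr0 => [|i' /negPf ne_i]; last first.
  by apply: big1 => m _; rewrite /log_eqn /= ne_i raddf0 scaler0.
rewrite /trunc_poly big_distrr -sumrN; apply: eq_bigr => m _ /=.
rewrite /log_eqn /= eqxx raddfN /= rmorphM /= map_mpolyX map_mpoly_linform.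
by rewrite scalerN scalerAr.
Qed.

Lemma log_lift :
  almost_all_primes (fun p => forall f : 'I_l -> {mpoly 'F_p[l]},
    (forall j, msize (f j) <= e.+1)%N -> in_logder (map_mx intr AZ) f ->
    exists F : 'I_l -> {mpoly int[l]},
      [/\ forall j, (msize (F j) <= e.+1)%N,
          forall j, map_mpoly intr (F j) = f j &
          in_logder (map_mx intr AZ : 'M[rat]_(n, l))
            (fun j => map_mpoly intr (F j))]).
Proof.
have [N NP] := mpoly_system_lift log_eqn; exists N => p pr_p ltp f szf logf.
have /fin_all_exists[q qP] : forall i, exists q : {mpoly 'F_p[l]},
    (msize q <= e.+1)%N /\
    \sum_j (AZ i j)%:~R *: f j = linform (fun j => (AZ i j)%:~R) * q.
  move=> i; have [q] := logf i; rewrite der_app_lform.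
  have -> : lform (map_mx intr AZ) i =
      linform (fun j => (AZ i j)%:~R : 'F_p).
    by apply: eq_bigr => j _; rewrite mxE.
  under eq_bigr => j _ do rewrite mxE.
  (* The quotient must fit the truncation degree [e]. If the form vanishes modulo [p], the quotient
     is arbitrary and 0 is taken; otherwise its degree is at most that of the product. *)
  have [-> | a0] := eqVneq (linform (fun j => (AZ i j)%:~R : 'F_p)) 0.
    by rewrite mul0r => ->; exists 0; rewrite mulr0 msize0.
  have [-> | q0] := eqVneq q 0; first by exists 0; rewrite msize0.
  move=> def_q; exists q; split=> //.
  have: (msize (linform (fun j => (AZ i j)%:~R : 'F_p) * q) <= e.+1)%N.
    rewrite -def_q; apply: leq_trans (msize_sum _ _ _) _.
    by apply/bigmax_leqP => j _; apply: leq_trans (msizeZ_le _ _) _.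
  apply: leq_trans; rewrite msizeM //.
  move: a0; rewrite -msize_poly_eq0; case: (msize _) => // k _.
  by rewrite addSn leq_addl.
pose x (t : log_index) := match t.1 with
  | inl j => (f j)@_t.2 | inr i => (q i)@_t.2 end.
have xl j : trunc_poly x (inl j) = f j by rewrite [RHS](mpolywE (szf j)).
have xr i : trunc_poly x (inr i) = q i by rewrite [RHS](mpolywE (qP i).1).
have [i | X XP Xx] := NP p pr_p ltp x.
  rewrite log_eqnE; under eq_bigr => j _ do rewrite xl.
  by rewrite (qP i).2 xr subrr.
have map_trunc (R : comNzRingType) u :
    map_mpoly intr (trunc_poly X u) = trunc_poly (fun t => (X t)%:~R : R) u.
  by rewrite raddf_sum; apply: eq_bigr => m _ /=; rewrite map_mpolyZ map_mpolyX.
exists (fun j => trunc_poly X (inl j)); split=> [j | j | i].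
- exact: msize_trunc_poly.
- rewrite map_trunc -xl; apply: eq_bigr => m _; by rewrite Xx.
exists (trunc_poly (fun t => (X t)%:~R) (inr i)); apply/eqP.
rewrite der_app_lform -subr_eq0; apply/eqP.
rewrite -[RHS](raddf0 (map_mpoly intr)) -(XP i) raddf_sum /=.
under [RHS]eq_bigr => t _ do rewrite map_mpolyZ.
rewrite log_eqnE; congr (_ - _ * _).
  by apply: eq_bigr => j _; rewrite mxE map_trunc.
by apply: eq_bigr => j _; rewrite mxE.
Qed.

End LogSystem.

Lemma saito_lift n l (AZ : 'M[int]_(n, l)) :
  almost_all_primes (fun p => saito (map_mx intr AZ : 'M['F_p]_(n, l)) ->
    saito (map_mx intr AZ : 'M[rat]_(n, l))).
Proof.
(* Each [d k] is at most [n], so finitely many lifting bounds combine into one that is independent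
   of the family. *)
have [N NP] := almost_all_primes_forall (fun e : 'I_n.+1 => log_lift e AZ).
exists N => p pr_p ltp [d [M [sum_d logM szM detM0]]].
have /fin_all_exists[F FP] : forall k : 'I_l, exists F : 'I_l -> {mpoly int[l]},
      [/\ forall j, (msize (F j) <= (d k).+1)%N,
          forall j, map_mpoly intr (F j) = M k j &
          in_logder (map_mx intr AZ : 'M[rat]_(n, l))
            (fun j => map_mpoly intr (F j))].
  move=> k; have lt_dn : (d k < n.+1)%N.
    by rewrite ltnS; apply: leq_trans sum_d; rewrite (bigD1 k) //= leq_addr.
  exact: (NP p pr_p ltp (Ordinal lt_dn) (M k) (szM k) (logM k)).
pose MZ : 'M[{mpoly int[l]}]_l := \matrix_(k, j) F k j.
have MZp : map_mx (map_mpoly intr) MZ = M.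
  by apply/matrixP => k j; rewrite !mxE; have [_ ->] := FP k.
exists d, (map_mx (map_mpoly intr) MZ); split=> // [k i | k j |].
- have [_ _ /(_ i)[q def_q]] := FP k; exists q; rewrite -def_q.
  by rewrite !der_app_lform; apply: eq_bigr => j _; rewrite !mxE.
- rewrite !mxE; apply: leq_trans (msize_map_mpoly _ _) _.
  by have [-> _] := FP k.
rewrite det_map_mx -[X in _ != X](raddf0 (map_mpoly intr)).
rewrite (inj_eq (@map_mpoly_intr_inj l)).
by apply: contraNneq detM0 => det0; rewrite -MZp det_map_mx det0 raddf0.
Qed.

Lemma mpoly_common_denom l (T : finType) (f : T -> {mpoly rat[l]}) :
  exists2 D : int, D != 0 &
  exists F : T -> {mpoly int[l]},
    forall t, map_mpoly intr (F t) = D%:~R *: f t.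
Proof.
have /fin_all_exists2[D D0 DP] : forall t, exists2 D : int, D != 0 &
    exists F : {mpoly int[l]}, map_mpoly intr F = D%:~R *: f t.
  move=> t; elim/mpolyind: (f t) => [|c m p _ _ [D D0 [F FP]]].
    by exists 1 => //; exists 0; rewrite raddf0 scaler0.
  exists (denq c * D); first by rewrite mulf_neq0 ?denq_neq0.
  exists ((numq c * D) *: 'X_[m] + denq c *: F).
  rewrite raddfD /= !map_mpolyZ map_mpolyX FP scalerDr !scalerA !rmorphM /=.
  by rewrite numqE (mulrC c) mulrAC.
have /fin_all_exists[F FP] := DP.
exists (\prod_t D t); first by apply/prodf_neq0 => t _; apply: D0.
exists (fun t => (\prod_(t' | t' != t) D t') *: F t) => t.
by rewrite map_mpolyZ FP scalerA -rmorphM /= [in RHS](bigD1 t) //= mulrC.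
Qed.

Lemma saito_reduce n l (AZ : 'M[int]_(n, l)) :
  saito (map_mx intr AZ : 'M[rat]_(n, l)) ->
  almost_all_primes (fun p => saito (map_mx intr AZ : 'M['F_p]_(n, l))).
Proof.
case=> d [M [sum_d logM szM detM0]].
have /fin_all_exists[q qP] : forall k, exists q, forall i,
    \sum_j (AZ i j)%:~R *: M k j = linform (fun j => (AZ i j)%:~R) * q i.
  move=> k; have /fin_all_exists[q qP] := logM k; exists q => i.
  have := qP i; rewrite der_app_lform; under eq_bigr => j _ do rewrite mxE.
  by move=> ->; congr (_ * _); apply: eq_bigr => j _; rewrite mxE.
(* Fields and quotients share one denominator, so that the logarithmic equations hold over the
   integers and can be reduced modulo [p]. *)
have [D D0 [F FP]] := mpoly_common_denom
  (fun t : 'I_l * ('I_l + 'I_n) =>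
     match t.2 with inl j => M t.1 j | inr i => q t.1 i end).
pose MZ : 'M[{mpoly int[l]}]_l := \matrix_(k, j) F (k, inl j).
have MZq : map_mx (map_mpoly intr) MZ = (D%:~R : rat)%:MP *: M.
  by apply/matrixP => k j; rewrite !mxE FP mul_mpolyC.
have logMZ k i : \sum_j AZ i j *: MZ k j = linform (AZ i) * F (k, inr i).
  apply: map_mpoly_intr_inj; rewrite rmorphM raddf_sum /= map_mpoly_linform.
  rewrite FP -scalerAr [_ * q k i](esym (qP k i)) scaler_sumr.
  by apply: eq_bigr => j _; rewrite map_mpolyZ mxE FP !scalerA mulrC.
have szMZ k j : (msize (MZ k j) <= (d k).+1)%N.
  apply: leq_trans (szM k j); rewrite msizeE; apply/bigmax_leqP_seq => m + _.
  rewrite !mcoeff_msupp => MZm; apply: msize_mdeg_lt; rewrite mcoeff_msupp.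
  have /mpolyP/(_ m) := congr1 (fun B : 'M_l => B k j) MZq.
  rewrite !mxE mul_mpolyC mcoeffZ mcoeff_map_mpoly => eq_m.
  apply: contraNneq MZm => Mm0; move/eqP: eq_m.
  by rewrite Mm0 mulr0 intr_eq0 mxE.
have detMZ0 : \det MZ != 0.
  apply: contraNneq detM0 => det0; have := congr1 determinant MZq.
  rewrite det_map_mx det0 raddf0 detZ => /esym/eqP.
  by rewrite mulf_eq0 expf_eq0 mpolyC_eq0 intr_eq0 (negPf D0) andbF.
have [N NP] := map_mpoly_Fp_neq0 detMZ0; exists N => p pr_p ltp.
exists d, (map_mx (map_mpoly intr) MZ); split=> // [k i | k j |].
- exists (map_mpoly intr (F (k, inr i))); rewrite der_app_lform.
  have := congr1 (map_mpoly intr : _ -> {mpoly 'F_p[l]}) (logMZ k i).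
  rewrite rmorphM raddf_sum /= map_mpoly_linform => eq_k.
  have -> : lform (map_mx intr AZ) i =
      linform (intr \o AZ i) :> {mpoly 'F_p[l]}.
    by apply: eq_bigr => j _; rewrite mxE.
  by rewrite -eq_k; apply: eq_bigr => j _; rewrite !mxE map_mpolyZ.
- by rewrite mxE; apply: leq_trans (msize_map_mpoly _ _) _.
by rewrite det_map_mx; apply: NP.
Qed.

(** * Intersection ranks and combinatorial equivalence *)

(** Rows outside [I] are zeroed rather than removed: the shape stays fixed and the rank is that of
    the selected forms. *)
Definition sub_rows (R : nzRingType) n l (A : 'M[R]_(n, l)) (I : {set 'I_n}) :
  'M[R]_(n, l) := \matrix_(i, j) if i \in I then A i j else 0.

Lemma rank_inter_space (K : fieldType) n l (A : 'M[K]_(n, l)) I :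
  \rank (inter_space A I) = (l - \rank (sub_rows A I))%N.
Proof.
rewrite -(mxrank_tr (sub_rows A I)) -mxrank_ker; apply/eqmx_rank.
apply/andP; split.
  apply/sub_kermxP/matrixP => u i; rewrite !mxE.
  have [Ii | nIi] := boolP (i \in I); last first.
    by apply: big1 => j _; rewrite !mxE (negPf nIi) mulr0.
  have /sub_kermxP : (inter_space A I <= hyp_space A i)%MS.
    by have /sub_bigcapmxP := submx_refl (inter_space A I); apply.
  move=> /matrixP/(_ u 0); rewrite !mxE => hu; rewrite -[RHS]hu.
  by apply: eq_bigr => j _; rewrite !mxE Ii.
apply/sub_bigcapmxP => i Ii; apply/sub_kermxP/matrixP => u v.
have := congr1 (fun B : 'M_(l, n) => B u i) (mulmx_ker (sub_rows A I)^T).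
rewrite /= !mxE => hu; rewrite -[RHS]hu.
by apply: eq_bigr => j _; rewrite !mxE Ii.
Qed.

(** Intersection ranks detect both conditions: a form is zero when its singleton has rank [l], and
    two hyperplanes agree when their intersection has the rank of each. *)
Lemma comb_equiv_arrangement (K1 K2 : fieldType) n l
    (A1 : 'M[K1]_(n, l)) (A2 : 'M[K2]_(n, l)) :
  comb_equiv A1 A2 -> is_arrangement A1 -> is_arrangement A2.
Proof.
have inter1 (K : fieldType) (A : 'M[K]_(n, l)) i :
    inter_space A [set i] = hyp_space A i.
  by rewrite /inter_space big_set1.
have row_rank (K : fieldType) (A : 'M[K]_(n, l)) i :
    (row i A != 0) = (\rank (inter_space A [set i]) != l).
  rewrite inter1 mxrank_ker mxrank_tr -mxrank_eq0.
  rewrite -[in RHS](eqn_add2r (\rank (row i A))) subnK ?rank_leq_col //.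
  have := eqn_add2l l 0 (\rank (row i A)).
  by rewrite addn0 eq_sym => ->; rewrite eq_sym.
have hyp_rank (K : fieldType) (A : 'M[K]_(n, l)) i j : i != j ->
    (hyp_space A i == hyp_space A j)%MS =
    (\rank (inter_space A [set i; j]) == \rank (inter_space A [set i])) &&
    (\rank (inter_space A [set i; j]) == \rank (inter_space A [set j])).
  move=> ne_ij; rewrite !inter1 /inter_space big_setU1 ?inE //= big_set1.
  rewrite !(mxrank_leqif_sup (capmxSl _ _)) !(mxrank_leqif_sup (capmxSr _ _)).
  by rewrite !sub_capmx !submx_refl andbT.
move=> eqA [nz ne]; split=> [i | i j ne_ij].
  by rewrite row_rank -eqA -row_rank.
by rewrite hyp_rank // -!eqA -hyp_rank // ne.
Qed.

Lemma comb_equiv_scale (K : fieldType) n l (A : 'M[K]_(n, l)) c :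
  c != 0 -> comb_equiv A (c *: A).
Proof.
move=> c0 I; rewrite !rank_inter_space.
rewrite (_ : sub_rows (c *: A) I = c *: sub_rows A I) ?mxrank_scale_nz //.
by apply/matrixP => i j; rewrite !mxE; case: ifP => // _; rewrite mulr0.
Qed.

Lemma comb_equiv_mod_p n l (AZ : 'M[int]_(n, l)) :
  almost_all_primes (fun p => comb_equiv (map_mx intr AZ : 'M[rat]_(n, l))
                                     (map_mx intr AZ : 'M['F_p]_(n, l))).
Proof.
have [N NP] := almost_all_primes_forall
  (fun I : {set 'I_n} => rank_mod_p (sub_rows AZ I)).
exists N => p pr_p ltp I; rewrite !rank_inter_space.
have mapI (R : fieldType) :
    sub_rows (map_mx intr AZ) I = map_mx intr (sub_rows AZ I) :> 'M[R]_(n, l).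
  by apply/matrixP => i j; rewrite !mxE; case: ifP; rewrite ?rmorph0.
by rewrite !mapI NP.
Qed.

(** * Scaling to integer coefficients and the final transfer *)

Lemma free_scale (K : fieldType) n l (A : 'M[K]_(n, l)) c :
  c != 0 -> free_arr A -> free_arr (c *: A).
Proof.
move=> c0; have logE f : in_logder (c *: A) f <-> in_logder A f.
  have der i : der_app f (lform (c *: A) i) = c *: der_app f (lform A i).
    rewrite !der_app_lform scaler_sumr; apply: eq_bigr => j _.
    by rewrite mxE scalerA.
  have lfm i : lform (c *: A) i = c *: lform A i.
    by rewrite /lform scaler_sumr; apply: eq_bigr => j _; rewrite mxE scalerA.
  split=> logf i; have [q def_q] := logf i; exists q.
    by move: def_q; rewrite der lfm -scalerAl => /(scalerI c0).
  by rewrite der lfm def_q scalerAl.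
case=> m [b [logb genb freeb]]; exists m, b; split=> // [k | f /logE].
  exact/logE.
exact: genb.
Qed.

Lemma free_saitoP (K : fieldType) n l (A : 'M[K]_(n, l)) :
  is_arrangement A -> free_arr A <-> saito A.
Proof.
move=> arrA; have [s [sP s_neq0]] := eliminators arrA.
split; first exact: (free_saito arrA sP s_neq0).
exact: (saito_free arrA sP s_neq0).
Qed.

Lemma integral_scale n l (A : 'M[rat]_(n, l)) :
  exists2 D : int, D != 0 &
  exists AZ : 'M[int]_(n, l), map_mx intr AZ = D%:~R *: A.
Proof.
(* Matrix entries are treated as polynomials in zero variables and recovered as constant
   coefficients. *)
have [D D0 [F FP]] :=
  mpoly_common_denom (fun t : 'I_n * 'I_l => (A t.1 t.2)%:MP_[0]).
exists D => //; exists (\matrix_(i, j) (F (i, j))@_0); apply/matrixP => i j.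
have /mpolyP/(_ 0%MM) := FP (i, j).
by rewrite mcoeff_map_mpoly mcoeffZ mcoeffC eqxx mulr1 !mxE.
Qed.

Lemma free_transfer n l (A1 A2 : 'M[rat]_(n, l)) : (1 <= l)%N ->
  (forall p, prime p -> terao_conj 'F_p) ->
  is_arrangement A1 -> is_arrangement A2 -> comb_equiv A1 A2 ->
  free_arr A1 -> free_arr A2.
Proof.
move=> l_gt0 teraoFp arr1 arr2 eq12 free1.
have [D1 D1_0 [B1 def_B1]] := integral_scale A1.
have [D2 D2_0 [B2 def_B2]] := integral_scale A2.
have eqA1B1 : comb_equiv A1 (map_mx intr B1 : 'M[rat]_(n, l)).
  by rewrite def_B1; apply: comb_equiv_scale; rewrite intr_eq0.
have eqA2B2 : comb_equiv A2 (map_mx intr B2 : 'M[rat]_(n, l)).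
  by rewrite def_B2; apply: comb_equiv_scale; rewrite intr_eq0.
have arrB1 := comb_equiv_arrangement eqA1B1 arr1.
have arrB2 := comb_equiv_arrangement eqA2B2 arr2.
have saito1 : saito (map_mx intr B1 : 'M[rat]_(n, l)).
  apply/free_saitoP => //; rewrite def_B1.
  by apply: free_scale; rewrite ?intr_eq0.
(* One prime serves for both rank comparisons, the reduction of [B1] and the lifting for [B2]. *)
have [p pr_p [[[eqB1 eqB2] saitoB1p] saitoB2]] := almost_all_primes_ex
  (almost_all_primes_and (almost_all_primes_and
    (almost_all_primes_and (comb_equiv_mod_p B1) (comb_equiv_mod_p B2))
    (saito_reduce saito1)) (saito_lift B2)).
have arrB1p := comb_equiv_arrangement eqB1 arrB1.
have arrB2p := comb_equiv_arrangement eqB2 arrB2.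
have eqBp : comb_equiv (map_mx intr B1 : 'M['F_p]_(n, l))
    (map_mx intr B2 : 'M['F_p]_(n, l)).
  by move=> I; rewrite -eqB1 -eqA1B1 eq12 eqA2B2 eqB2.
have free1p := (free_saitoP arrB1p).2 saitoB1p.
have free2p := (teraoFp p pr_p l l_gt0 n _ _ arrB1p arrB2p eqBp).1 free1p.
have freeB2 := (free_saitoP arrB2).2 (saitoB2 ((free_saitoP arrB2p).1 free2p)).
have D2V : (D2%:~R : rat)^-1 != 0 by rewrite invr_eq0 intr_eq0.
have := free_scale D2V freeB2; rewrite def_B2 scalerA mulVf ?scale1r //.
by rewrite intr_eq0.
Qed.

Theorem theorem5p5 :
  (forall p : nat, prime p -> terao_conj ('F_p : fieldType)) ->
  terao_conj (rat : fieldType).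
Proof.
move=> teraoFp l l_gt0 n A1 A2 arr1 arr2 eq12; split.
  exact: free_transfer.
by apply: free_transfer => // I; rewrite eq12.
Qed.
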